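(* Let $(M,c,\sigma)$ be almost Einstein, $\Sigma$ the zero locus of $\sigma$, and $w$ a weight. Away from $\Sigma$, in the Einstein scale $g^o=\sigma^{-2}\boldsymbol g$, the tractor Proca equations $$y\mathcal A=\widehat{\mathscr D}^\star\mathcal A=\mathscr X^\star\mathcal A=\mathscr I^\star\mathcal A=0,\qquad \mathcal A\in\Gamma\mathcal T^kM[w],$$ precisely capture the Proca equations $$\boldsymbol\delta\mathbf dA-m^2A=0=\boldsymbol\delta A,\qquad A\in\Gamma\mathcal E^kM[w+k],$$ with mass--Weyl weight relationship $$m^2=-\frac{2J}{d}(w+k)(n+w-k).$$ That is, taking the western slot of $\mathcal A$ in the scale $g^o$ gives a bijection from solutions $\mathcal A$ of the former system on $M\setminus\Sigma$ onto solutions $A$ of the latter system on $M\setminus\Sigma$ (with $\mathbf d,\boldsymbol\delta,J$ computed in the scale $g^o$).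
   Context: Conformal conventions. $M$ is a smooth manifold of dimension $d=n+1\ge3$ with conformal class $c$. $\mathcal EM[w]$: conformal densities of weight $w$ (families $\mu_g$, $g\in c$, with $\mu_{\Omega^2g}=\Omega^w\mu_g$); each scale $g\in c$ trivialises them; indices are moved with the conformal metric $\boldsymbol g$. $\mathcal E^kM[w]=\Lambda^kT^*M\otimes\mathcal EM[w]$. In a scale $g$: $\varepsilon,\iota$ are exterior/interior multiplication, $\mathbf d=\varepsilon(\nabla)$, $\boldsymbol\delta=\iota(\nabla)$ (minus the formal adjoint of $\mathbf d$), $\boldsymbol\Delta=\mathbf d\boldsymbol\delta+\boldsymbol\delta\mathbf d$; $\mathrm{Ric}=(d-2)P+Jg$, $J=P^a{}_a$, and $\mathbb P$ is the endomorphism $P^a{}_b$ extended to forms as a derivation. Almost Einstein: $\sigma\in\Gamma\mathcal EM[1]$ is a section such that, in any scale $g$, with $\nu=\nabla\sigma$, $\rho=-\frac1d(\nabla^a\nabla_a\sigma+J\sigma)$, the triple $I=(\sigma,\nu,\rho)$ is non-zero and tractor-parallel: $\nabla_a\nu_b=-\sigma P_{ab}-\rho\,g_{ab}$, $\nabla_a\rho=P_{ab}\nu^b$. Then $\sigma\ne0$ on an open dense set, where $g^o=\sigma^{-2}\boldsymbol g$ is Einstein. Tractor forms. For $g\in c$, $\mathcal T^kM[w]\cong\mathcal E^{k-1}M[w+k]\oplus\mathcal E^kM[w+k]\oplus\mathcal E^{k-2}M[w+k-2]\oplus\mathcal E^{k-1}M[w+k-2]$; sections are $\mathcal F=(F^+,F,F^{+-},F^-)$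 (north, west, east, south slots). Under $\hat g=\Omega^2g$, $\Upsilon=\mathbf d\log\Omega$: $\hat F^+=F^+$, $\hat F=F+\varepsilon(\Upsilon)F^+$, $\hat F^{+-}=F^{+-}-\iota(\Upsilon)F^+$, $\hat F^-=F^-+\frac12(\varepsilon(\Upsilon)\iota(\Upsilon)-\iota(\Upsilon)\varepsilon(\Upsilon))F^+-\iota(\Upsilon)F-\varepsilon(\Upsilon)F^{+-}$. Invariant operators on $\mathcal T^kM[w]$: $\mathscr X^\star\mathcal F=(0,F^+,0,F^{+-})$; $\mathscr I^\star\mathcal F=(-\iota(\nu)F^+-\sigma F^{+-},\ \rho F^++\iota(\nu)F+\sigma F^-,\ \iota(\nu)F^{+-},\ \rho F^{+-}-\iota(\nu)F^-)$; $\mathscr D:\Gamma\mathcal T^kM[w]\to\Gamma\mathcal T^{k+1}M[w-1]$ with slots north: $(d+2w-2)\big((w+k)F-\mathbf dF^+\big)$; west: $(d+2w-2)\mathbf dF$; east: $\big(\boldsymbol\Delta+(w+k-2)(J-2\mathbb P)\big)F^+-2\boldsymbol\delta F+(d+2w)\big(\mathbf dF^{+-}+(w+k-2)F^-\big)$; south: $[J-2\mathbb P,\mathbf d]F^+-\big(\boldsymbol\Delta+(w+k)(J-2\mathbb P)\big)F-(d+2w)\mathbf dF^-$. $y:=-(\mathscr I^\star\mathscr D+\mathscr D\mathscr I^\star):\Gamma\mathcal T^kM[w]\to\Gamma\mathcal T^kM[w-1]$. On $\ker\mathscr X^\star$, i.e. on $\mathcal A=(0,A,0,\phi)$, $\widehat{\mathscr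 D}^\star(0,A,0,\phi)=(0,\ \boldsymbol\delta A+(d+w-k)\phi,\ 0,\ -\boldsymbol\delta\phi)$. *)

(* Defs.v *)
From HB Require Import structures.
From mathcomp Require Import all_boot all_order all_algebra.
From mathcomp Require Import all_classical all_reals all_analysis.

Set Implicit Arguments.
Unset Strict Implicit.
Unset Printing Implicit Defensive.

Import Order.TTheory GRing.Theory Num.Theory.
Import numFieldNormedType.Exports.

Local Open Scope classical_set_scope.
Local Open Scope ring_scope.

Definition pderiv (R : realType) (d : nat) (a : 'I_d)
    (f : 'rV[R]_d -> R^o) : 'rV[R]_d -> R^o :=
  fun x => 'D_(delta_mx 0 a) f x.

(** C^infinity on [O]: every iterated partial derivative is differentiable at
    every point of [O] (hence they are all continuous there). *)
Definition smooth_on (R : realType) (d : nat) (O : set 'rV[R]_d)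
    (f : 'rV[R]_d -> R^o) : Prop :=
  forall (s : seq 'I_d) (x : 'rV[R]_d), O x ->
    differentiable (foldr (@pderiv R d) f s) x.

(** The charts form a smooth atlas, not necessarily the maximal one.
    [coord i] and [param i] are meaningful only on [dom i] and on
    [coord i @` dom i], where they are inverse to each other. *)
Record manifold (R : realType) (d : nat) := Manifold {
  pt :> topologicalType;
  chart : Type;
  dom : chart -> set pt;
  coord : chart -> pt -> 'rV[R]_d;
  param : chart -> 'rV[R]_d -> pt;
  pt_hausdorff : hausdorff_space pt;
  pt_second_countable : @second_countable pt;
  dom_open : forall i, open (dom i);
  dom_cover : forall p, exists i, dom i p;
  coordK : forall i p, dom i p -> param i (coord i p) = p;
  codom_open : forall i, open (coord i @` dom i);
  coord_continuous : forall i, {within dom i, continuous (coord i)};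
  param_continuous : forall i,
    {within coord i @` dom i, continuous (param i)};
  transition_smooth : forall i j (a : 'I_d),
    smooth_on (coord i @` (dom i `&` dom j))
              (fun x => coord j (param i x) 0 a)
}.

Section Tensors.
Context {R : realType} {d : nat} (M : manifold R d).

(** Chart-dependent scalars (such as the coefficient functions of a tensor
    field) and covariant tensor fields.  The component of [T] with indices
    [a1 ... ar] in the chart [i] at the point [p] is
    [T i p [:: a1; ...; ar]].  A tensor field of rank r is one whose
    components vanish on the index sequences of length other than r.  Values
    at a point outside the chart or outside the domain of the field carry no
    meaning. *)
Definition scal := chart M -> pt M -> R.
Definition field := chart M -> pt M -> seq 'I_d -> R.
Definition metric := chart M -> pt M -> 'M[R]_d.

Definition fzero : field := fun _ _ _ => 0.
Definition fadd (S T : field) : field := fun i p s => S i p s + T i p s.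
Definition fsub (S T : field) : field := fun i p s => S i p s - T i p s.
Definition fopp (T : field) : field := fun i p s => - T i p s.
Definition fscale (r : R) (T : field) : field := fun i p s => r * T i p s.
Definition fmul (f : scal) (T : field) : field := fun i p s => f i p * T i p s.

Definition of_fun (f : pt M -> R) : field :=
  fun i p s => if s is [::] then f p else 0.

Definition partial (i : chart M) (a : 'I_d) (f : pt M -> R) (p : pt M) : R :=
  pderiv a (fun x => f (param i x)) (coord i p).

Definition smooth_fun_on (W : set (pt M)) (i : chart M) (f : pt M -> R) : Prop :=
  smooth_on (coord i @` (W `&` dom i)) (fun x => f (param i x)).

Definition smooth_scalar (W : set (pt M)) (f : pt M -> R) : Prop :=
  forall i, smooth_fun_on W i f.

(** Jacobian of the change of coordinates: the entry [a, b] is the derivative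
    of the [b]-th coordinate of [j] along the [a]-th coordinate of [i]. *)
Definition jac (i j : chart M) (p : pt M) : 'M[R]_d :=
  \matrix_(a, b) partial i a (fun q => coord j q 0 b) p.

Fixpoint pull (D : 'M[R]_d) (T : seq 'I_d -> R) (s : seq 'I_d) : R :=
  if s is a :: s' then \sum_b D a b * pull D (fun t => T (b :: t)) s'
  else T [::].

Definition alternating (T : seq 'I_d -> R) : Prop :=
  forall s t a b, T (s ++ a :: b :: t) = - T (s ++ b :: a :: t).

(** Smooth differential forms of degree [k] over the open set [W].  There are
    no nonzero forms of negative degree, as [k] must be the length of an index
    sequence.  Components outside [W] or outside the chart are set to 0, so
    that two forms over [W] are equal functions as soon as they agree on [W]. *)
Definition is_form (W : set (pt M)) (k : int) (T : field) : Prop :=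
  [/\ forall i p s, ~ (W p /\ dom i p) -> T i p s = 0,
      forall i p s, (size s)%:Z != k -> T i p s = 0,
      forall i p, alternating (T i p),
      forall i s, smooth_fun_on W i (fun p => T i p s) &
      forall i j p s, W p -> dom i p -> dom j p ->
        T i p s = pull (jac i j p) (T j p) s].

Definition vanishes_on (W : set (pt M)) (T : field) : Prop :=
  forall i p s, W p -> dom i p -> T i p s = 0.

(** Smooth metrics over the open set [W], of any signature. *)
Definition is_metric (W : set (pt M)) (g : metric) : Prop :=
  [/\ forall i p, W p -> dom i p -> (g i p)^T = g i p,
      forall i p, W p -> dom i p -> g i p \in unitmx,
      forall i a b, smooth_fun_on W i (fun p => g i p a b) &
      forall i j p, W p -> dom i p -> dom j p ->
        g i p = jac i j p *m g j p *m (jac i j p)^T].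

Section Operators.
Variable g : metric.

Definition ginv : metric := fun i p => invmx (g i p).

(** Christoffel symbols: [chris i p c a b] has upper index [c]. *)
Definition chris (i : chart M) (p : pt M) (c a b : 'I_d) : R :=
  2^-1 * \sum_e ginv i p c e *
    (partial i a (fun q => g i q e b) p + partial i b (fun q => g i q e a) p
     - partial i e (fun q => g i q a b) p).

(** Levi-Civita derivative; the differentiation index comes first. *)
Definition nabla (T : field) : field := fun i p s =>
  if s is a :: s' then
    partial i a (fun q => T i q s') p
    - \sum_(j < size s') \sum_c
        chris i p c a (tnth (in_tuple s') j) * T i p (set_nth a s' j c)
  else 0.

(** [Ric_ab = d_c G^c_ab - d_a G^c_cb + G^c_ce G^e_ab - G^c_ae G^e_cb], which
    is positive on round spheres. *)
Definition ricci : metric := fun i p => \matrix_(a, b)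
  (\sum_c (partial i c (fun q => chris i q c a b) p
           - partial i a (fun q => chris i q c c b) p)
   + \sum_c \sum_e (chris i p c c e * chris i p e a b
                    - chris i p c a e * chris i p e c b)).

Definition scalar_curvature : scal := fun i p => \tr (ginv i p *m ricci i p).

(** [schouten] and [J] are the solution of [Ric = (d - 2) P + J g],
    [J = P^a_a]. *)
Definition J : scal := fun i p =>
  scalar_curvature i p / (2 * (d%:R - 1)).

Definition schouten : metric := fun i p =>
  (d%:R - 2)^-1 *: (ricci i p - J i p *: g i p).

Definition del_nth (s : seq 'I_d) (j : nat) : seq 'I_d :=
  take j s ++ drop j.+1 s.

(** For a tensor alternating in all its indices but the first: [wedge]
    antisymmetrizes the first index with the others, [contract] contracts it
    with the second one.  Then [eps u], [iota u], [ext_d], [codiff] are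
    exterior and interior multiplication by [u] and by [nabla]. *)
Definition wedge (T : field) : field := fun i p s =>
  \sum_(j < size s)
    (-1) ^+ j * T i p (tnth (in_tuple s) j :: del_nth s j).

Definition contract (T : field) : field := fun i p s =>
  \sum_a \sum_b ginv i p a b * T i p (a :: b :: s).

Definition outer (u T : field) : field := fun i p s =>
  if s is a :: s' then u i p [:: a] * T i p s' else 0.

Definition eps (u T : field) : field := wedge (outer u T).
Definition iota (u T : field) : field := contract (outer u T).
Definition ext_d (T : field) : field := wedge (nabla T).
Definition codiff (T : field) : field := contract (nabla T).
Definition laplace (T : field) : field :=
  fadd (ext_d (codiff T)) (codiff (ext_d T)).

(** The endomorphism [P^a_b] acting on forms as a derivation:
    [sum_j P^c_(a_j) T_(a_1 .. c .. a_k)], with [c] in place [j]. *)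
Definition schouten_act (T : field) : field := fun i p s =>
  \sum_(j < size s) \sum_c
    let a := tnth (in_tuple s) j in
    (ginv i p *m schouten i p) c a * T i p (set_nth a s j c).

Definition JP (T : field) : field :=
  fsub (fmul J T) (fscale 2 (schouten_act T)).

End Operators.

Definition conformal_on (W : set (pt M)) (g h : metric) : Prop :=
  exists2 Omega : pt M -> R, smooth_scalar W Omega &
    forall p, W p -> 0 < Omega p /\
      forall i, dom i p -> h i p = Omega p ^+ 2 *: g i p.

Definition conformal_class (c : set metric) : Prop :=
  exists2 g : metric, is_metric setT g &
    c = [set h | is_metric setT h /\ conformal_on setT g h].

(** A (local) scale: a metric over the open set [sdom], conformal there to the
    members of [c].  Densities, being sections of bundles, are trivialised by
    the scales over any open set, in particular by the Einstein scale, which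
    exists only off the zero locus. *)
Record scale := Scale { sdom : set (pt M); smet :> metric }.

Definition is_scale (c : set metric) (g : scale) : Prop :=
  [/\ open (sdom g), is_metric (sdom g) g &
      exists2 g0, c g0 & conformal_on (sdom g) g0 g].

Definition rescaled_at (p : pt M) (omega : R) (g h : scale) : Prop :=
  0 < omega /\ forall i, dom i p -> smet h i p = omega ^+ 2 *: smet g i p.

Definition is_density (c : set metric) (w : R) (mu : scale -> pt M -> R) : Prop :=
  (forall g, is_scale c g -> smooth_scalar (sdom g) (mu g)) /\
  (forall g h p omega, is_scale c g -> is_scale c h ->
     sdom g p -> sdom h p -> rescaled_at p omega g h ->
     mu h p = omega `^ w * mu g p).

(** Weighted forms over the open set [W]: sections of
    [Lambda^k T^* (x) E[w]].  [mu g] is the form over [W `&` sdom g]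
    that trivialises [mu] in the scale [g]. *)
Definition wform := scale -> field.

Definition is_wform (c : set metric) (W : set (pt M)) (k : int) (w : R)
    (mu : wform) : Prop :=
  [/\ forall g, ~ is_scale c g -> mu g = fzero,
      forall g, is_scale c g -> is_form (W `&` sdom g) k (mu g) &
      forall g h p omega, is_scale c g -> is_scale c h ->
        W p -> sdom g p -> sdom h p -> rescaled_at p omega g h ->
        forall i s, dom i p -> mu h i p s = omega `^ w * mu g i p s].

Record slots (T : Type) := Slots { north : T; west : T; east : T; south : T }.

Definition map_slots (S T : Type) (f : S -> T) (F : slots S) : slots T :=
  Slots (f (north F)) (f (west F)) (f (east F)) (f (south F)).

Definition all_slots (T : Type) (P : T -> Prop) (F : slots T) : Prop :=
  [/\ P (north F), P (west F), P (east F) & P (south F)].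

(** The change of slots under [g -> Omega ^ 2 g], [u] being [d log Omega],
    with both sides trivialised in the scale [g]. *)
Definition change (g : metric) (u : field) (F : slots field) : slots field :=
  {| north := north F;
     west := fadd (west F) (eps u (north F));
     east := fsub (east F) (iota g u (north F));
     south := fsub (fsub (fadd (south F)
        (fscale 2^-1 (fsub (eps u (iota g u (north F)))
                           (iota g u (eps u (north F))))))
        (iota g u (west F))) (eps u (east F)) |}.

(** [F g] are the slots of the tractor form [F] in the scale [g]; they are
    weighted forms over [W `&` sdom g]. *)
Definition tractor := scale -> slots wform.

Definition triv (g : scale) (F : slots wform) : slots field :=
  map_slots (fun mu : wform => mu g) F.

(** Sections over the open set [W] of the tractor bundle [T^k M [w]]. *)
Definition is_tractor (c : set metric) (W : set (pt M)) (k : int) (w : R)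
    (F : tractor) : Prop :=
  [/\ forall g, ~ is_scale c g -> all_slots (fun mu => mu = fun=> fzero) (F g),
      forall g, is_scale c g -> let V := W `&` sdom g in
        [/\ is_wform c V (k - 1) (w + k%:~R) (north (F g)),
            is_wform c V k (w + k%:~R) (west (F g)),
            is_wform c V (k - 2) (w + k%:~R - 2) (east (F g)) &
            is_wform c V (k - 1) (w + k%:~R - 2) (south (F g))] &
      forall g h (Omega : pt M -> R), is_scale c g -> is_scale c h ->
        let V := W `&` sdom g `&` sdom h in
        smooth_scalar V Omega ->
        (forall p, V p -> rescaled_at p (Omega p) g h) ->
        let Fg := change g (nabla g (of_fun (fun p => ln (Omega p))))
                         (triv g (F g)) in
        let Fh := triv g (F h) in
        [/\ vanishes_on V (fsub (north Fh) (north Fg)),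
            vanishes_on V (fsub (west Fh) (west Fg)),
            vanishes_on V (fsub (east Fh) (east Fg)) &
            vanishes_on V (fsub (south Fh) (south Fg))]].

Definition grad (g : metric) (sigma : pt M -> R) : field :=
  nabla g (of_fun sigma).

Definition rho (g : metric) (sigma : pt M -> R) : scal := fun i p =>
  - (d%:R^-1 * (codiff g (grad g sigma) i p [::] + J g i p * sigma p)).

(** The triple [(sigma, nu, rho)] is required to be nonzero at each point; for
    a parallel section over a connected manifold this is the same as being
    nonzero somewhere. *)
Definition almost_einstein (c : set metric) (sigma : scale -> pt M -> R) : Prop :=
  is_density c 1 sigma /\
  forall g, is_scale c g -> forall i p, sdom g p -> dom i p ->
    let s := sigma g in
    let nu := grad g s in
    [/\ ~ [/\ s p = 0, forall a, nu i p [:: a] = 0 & rho g s i p = 0],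
        forall a b, nabla g nu i p [:: a; b] =
          - (s p * schouten g i p a b) - rho g s i p * smet g i p a b &
        forall a, partial i a (rho g s i) p =
          \sum_b \sum_e schouten g i p a b * ginv g i p b e * nu i p [:: e]].

Definition zero_locus (c : set metric) (sigma : scale -> pt M -> R) : set (pt M) :=
  [set p | exists g, [/\ is_scale c g, sdom g p & sigma g p = 0]].

(** [sigma ^ -2 bg], where [bg] is the conformal metric; it is computed from a
    metric [g] of the conformal class but does not depend on it. *)
Definition einstein_scale (c : set metric) (sigma : scale -> pt M -> R)
    (g : metric) : scale :=
  {| sdom := ~` zero_locus c sigma;
     smet := fun i p => sigma (Scale setT g) p ^- 2 *: g i p |}.

(** The slots, in the scale [g], of the invariant operators applied to the
    tractor form with slots [F] in this scale (everything being trivialised in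
    [g]). *)
Section TractorOperators.
Variable g : metric.

Definition Xstar (F : slots field) : slots field :=
  Slots fzero (north F) fzero (east F).

Definition Istar (s : pt M -> R) (F : slots field) : slots field :=
  let sigma : scal := fun _ p => s p in
  let nu := grad g s in
  let r := rho g s in
  {| north := fsub (fopp (iota g nu (north F))) (fmul sigma (east F));
     west := fadd (fadd (fmul r (north F)) (iota g nu (west F)))
                  (fmul sigma (south F));
     east := iota g nu (east F);
     south := fsub (fmul r (east F)) (iota g nu (south F)) |}.

(** For [F] in [T^k M [w]]; the result is in [T^(k+1) M [w - 1]]. *)
Definition Dtr (k : int) (w : R) (F : slots field) : slots field :=
  let D := d%:R : R in
  let wk := w + k%:~R in
  {| north := fscale (D + 2 * w - 2)
       (fsub (fscale wk (west F)) (ext_d g (north F)));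
     west := fscale (D + 2 * w - 2) (ext_d g (west F));
     east := fadd (fsub
       (fadd (laplace g (north F)) (fscale (wk - 2) (JP g (north F))))
       (fscale 2 (codiff g (west F))))
       (fscale (D + 2 * w)
          (fadd (ext_d g (east F)) (fscale (wk - 2) (south F))));
     south := fsub (fsub
       (fsub (JP g (ext_d g (north F))) (ext_d g (JP g (north F))))
       (fadd (laplace g (west F)) (fscale wk (JP g (west F)))))
       (fscale (D + 2 * w) (ext_d g (south F))) |}.

(** For [F] in [T^k M [w]]: [Istar] maps it to [T^(k-1) M [w]], whence the
    parameters of the second [Dtr]. *)
Definition ytr (s : pt M -> R) (k : int) (w : R) (F : slots field) : slots field :=
  let A := Istar s (Dtr k w F) in
  let B := Dtr (k - 1) w (Istar s F) in
  {| north := fopp (fadd (north A) (north B));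
     west := fopp (fadd (west A) (west B));
     east := fopp (fadd (east A) (east B));
     south := fopp (fadd (south A) (south B)) |}.

(** Defined on the kernel of [Xstar] only, i.e. when the north and east slots
    are zero. *)
Definition Dhat_star (k : int) (w : R) (F : slots field) : slots field :=
  {| north := fzero;
     west := fadd (codiff g (west F)) (fscale (d%:R + w - k%:~R) (south F));
     east := fzero;
     south := fopp (codiff g (south F)) |}.

End TractorOperators.

(** To be used for a scale [g] whose domain contains [W].  The operators being
    invariant, their values are computed in the scale [g]; the change of slots
    is invertible, so a tractor form over [W] is zero if and only if its slots
    in [g] are zero. *)
Definition tractor_proca (c : set metric) (sigma : scale -> pt M -> R)
    (W : set (pt M)) (g : scale) (k : int) (w : R) : set tractor :=
  [set F | is_tractor c W k w F /\
    let Fg := triv g (F g) in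
    [/\ all_slots (vanishes_on W) (ytr g (sigma g) k w Fg),
        all_slots (vanishes_on W) (Dhat_star g k w Fg),
        all_slots (vanishes_on W) (Xstar Fg) &
        all_slots (vanishes_on W) (Istar g (sigma g) Fg)]].

Definition proca (c : set metric) (W : set (pt M)) (g : scale) (k : int)
    (w : R) (m2 : scal) : set wform :=
  [set A | is_wform c W k w A /\
    [/\ vanishes_on W (fsub (codiff g (ext_d g (A g))) (fmul m2 (A g))) &
        vanishes_on W (codiff g (A g))]].

End Tensors.

(* Main.v *)
(** In the Einstein scale [go] the density [sigma] has square [1] off its zero
    locus, so [nu = 0], [rho = - sigma J / d], and parallelism of [I] says
    [P = (J / d) g].  The algebraic equations [Xstar = Istar = 0] then force the
    slots of the tractor to be [(0, A, 0, 0)], for which [Dhat_star] gives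
    [codiff A = 0] and the west slot of [ytr] is [sigma (laplace A - m2 A)].
    A tractor form is determined by its slots in one scale.  Conversely a
    solution [A] extends to the tractor form with slots
    [(0, A, 0, - iota (d log sigma_h) A)] in the scale [h], because [sigma_h] is,
    up to sign, the conformal factor from [go] to [h]. *)
Require Import Defs.
From HB Require Import structures.
From mathcomp Require Import all_boot all_order all_algebra.
From mathcomp Require Import all_classical all_reals all_analysis.
From mathcomp Require Import ring.

Set Implicit Arguments.
Unset Strict Implicit.
Unset Printing Implicit Defensive.

Import Order.TTheory GRing.Theory Num.Theory.
(* [coord], [iota], [dom] are those of the geometry, not of MathComp. *)
Import Defs.
Import numFieldNormedType.Exports.

Local Open Scope classical_set_scope.
Local Open Scope ring_scope.

(** * Calculus of smooth functions *)

(** The two linear factors of the mass arise in the west slot of [ytr]. The north slot of [Dtr]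
    enters it through [rho] with the factor [d + 2 w - 2], while [J - 2 P] acts on [k]-forms as
    [(J / d) (d - 2 k)]. Both contributions carry [w + k], and [(d + 2 w - 2) + (d - 2 k) = 2 (n + w
    - k)]. The opposite order, [Dtr] after [Istar], contributes nothing, because [Istar] already
    kills the tractor. Two obstacles shape the proof. Fields are total functions whose values off
    [W] say nothing, so an equation on [W] can be differentiated only because [W] is open and every
    operator is local. Moreover the sign of [sigma] may vary over [W], while conformal factors are
    positive: the factors are therefore absolute values of [sigma], smooth off its zeros, and the
    lift uses [sigma^-1 d sigma], which does not see the sign. *)

Lemma near_eq_differentiable (R : numFieldType) (V W : normedModType R)
    (f g : V -> W) (x : V) :
  {near x, f =1 g} -> differentiable f x -> differentiable g x.
Proof.
move=> fg df.
have fx := nbhs_singleton fg.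
(* [g - f] vanishes near [x], so the zero map is its differential there; [g] is then recovered as
   [f + (g - f)]. *)
have e0 : (g - f) \o shift x = cst ((g - f) x) + (0 : V -> W) +o_ 0 id.
  apply/eqaddoP => e e0.
  have fgh : \forall h \near (0 : V), f (h + x) = g (h + x).
    by move: fg; rewrite (near_shift 0) /= subr0.
  apply: filterS fgh => h fgh.
  rewrite /= !fctE /= fgh fx !subrr.
  rewrite [0 h](_ : _ = 0) // !add0r oppr0 normr0.
  by rewrite mulr_ge0 // ltW.
have d0 : 'd (g - f) x = 0 :> (V -> W).
  by apply: diff_unique => //; exact: cst_continuous.
suff -> : g = f + (g - f).
  apply: differentiableD => //; apply/diff_locallyP.
  by rewrite d0; split => //; exact: cst_continuous.
by rewrite addrC subrK.
Qed.

Section SmoothCalculus.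
Context {R : realType} {d : nat}.
Implicit Types (O : set 'rV[R]_d) (f g : 'rV[R]_d -> R^o).

(** Finite orders of smoothness, along which closure under products and
    inverses is proved by induction. *)
Fixpoint Ck (m : nat) O f : Prop :=
  (forall x, O x -> differentiable f x) /\
  if m is m'.+1 then forall a, Ck m' O (pderiv a f) else True.

(** [Ck] peels off the derivative applied first, which [foldr] takes from the end of the list; hence
    [rcons] and the induction from the end. *)
Lemma smooth_onP O f : smooth_on O f <-> forall m, Ck m O f.
Proof.
split=> [sf m|Cf s].
  elim: m f sf => [|m IH] f sf; first by split=> // x Ox; exact: (sf [::]).
  split=> [x Ox|a]; first exact: (sf [::]).
  by apply: IH => s x Ox; have := sf (rcons s a) x Ox; rewrite foldr_rcons.
elim/last_ind: s f Cf => [|s a IH] f Cf x Ox; first exact: (Cf 0%N).1.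
by rewrite foldr_rcons; apply: IH => // m; have [_] := Cf m.+1; apply.
Qed.

Lemma Ck_diff m O f x : Ck m O f -> O x -> differentiable f x.
Proof. by case: m => [|m] [df _]; exact: df. Qed.

Lemma Ck_leS m O f : Ck m.+1 O f -> Ck m O f.
Proof.
elim: m f => [|m IH] f [df pf]; first by split.
by split=> // a; apply: IH; exact: pf.
Qed.

Lemma smooth_on_diff O f x : smooth_on O f -> O x -> differentiable f x.
Proof. by move=> sf; exact: (sf [::]). Qed.

Lemma smooth_on_pderiv O f a : smooth_on O f -> smooth_on O (pderiv a f).
Proof. by move=> sf s x Ox; have := sf (rcons s a) x Ox; rewrite foldr_rcons. Qed.

Lemma smooth_onS O O' f : O' `<=` O -> smooth_on O f -> smooth_on O' f.
Proof. by move=> OO sf s x /OO; exact: sf. Qed.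

Lemma pderiv_eq O f g a x : open O -> (forall y, O y -> f y = g y) -> O x ->
  pderiv a f x = pderiv a g x.
Proof.
move=> oO fg Ox; apply: near_eq_derive.
by apply: filterS (open_nbhs_nbhs (conj oO Ox)); exact: fg.
Qed.

Lemma diff_eq O f g x : open O -> (forall y, O y -> f y = g y) -> O x ->
  differentiable f x -> differentiable g x.
Proof.
move=> oO fg Ox; apply: near_eq_differentiable.
by apply: filterS (open_nbhs_nbhs (conj oO Ox)); exact: fg.
Qed.

Lemma Ck_eq m O f g : open O -> (forall y, O y -> f y = g y) ->
  Ck m O f -> Ck m O g.
Proof.
move=> oO; elim: m f g => [|m IH] f g fg [df pf].
  by split=> // x Ox; exact: (diff_eq oO fg Ox (df x Ox)).
split=> [x Ox|a]; first exact: (diff_eq oO fg Ox (df x Ox)).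
by apply: IH (pf a) => y Oy; exact: (pderiv_eq a oO fg Oy).
Qed.

Lemma Ck_cst m O (r : R) : Ck m O (cst r).
Proof.
elim: m r => [|m IH] r; split=> // a.
by rewrite (_ : pderiv a (cst r) = cst 0) //; apply/funext => x; exact: derive_cst.
Qed.

Lemma Ck_add m O f g : open O -> Ck m O f -> Ck m O g -> Ck m O (f + g).
Proof.
move=> oO; elim: m f g => [|m IH] f g [df pf] [dg pg].
  by split=> // x Ox; exact: differentiableD (df _ Ox) (dg _ Ox).
split=> [x Ox|a]; first exact: differentiableD (df _ Ox) (dg _ Ox).
apply: Ck_eq (IH _ _ (pf a) (pg a)) => // y Oy.
  by rewrite /pderiv deriveD //; apply: diff_derivable; auto.
Qed.

Lemma Ck_mul m O (f g : 'rV[R]_d -> R) :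
  open O -> Ck m O f -> Ck m O g -> Ck m O (f * g).
Proof.
move=> oO; elim: m f g => [|m IH] f g Cf Cg.
  by split=> // x Ox; exact: differentiableM (Ck_diff Cf Ox) (Ck_diff Cg Ox).
split=> [x Ox|a]; first exact: differentiableM (Ck_diff Cf Ox) (Ck_diff Cg Ox).
have /= [_ pf] := Cf; have /= [_ pg] := Cg.
  apply: Ck_eq (Ck_add oO (IH _ _ (Ck_leS Cf) (pg a)) (IH _ _ (Ck_leS Cg) (pf a)))
    => // y Oy.
  by rewrite /pderiv deriveM //; apply: diff_derivable;
    [exact: Ck_diff Cf Oy|exact: Ck_diff Cg Oy].
Qed.

Lemma Ck_inv m O (f : 'rV[R]_d -> R) : open O -> (forall x, O x -> f x != 0) ->
  Ck m O f -> Ck m O (fun x => (f x)^-1).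
Proof.
move=> oO f0; elim: m f f0 => [|m IH] f f0 Cf.
  by split=> // x Ox; exact: differentiableV (Ck_diff Cf Ox) (f0 x Ox).
split=> [x Ox|a]; first exact: differentiableV (Ck_diff Cf Ox) (f0 x Ox).
have /= [_ pf] := Cf; have Ci := IH _ f0 (Ck_leS Cf).
  apply: Ck_eq (Ck_mul oO (Ck_mul oO (Ck_cst m O (-1)) (Ck_mul oO Ci Ci)) (pf a))
    => // y Oy.
  rewrite /pderiv deriveV //; [|exact: f0|exact: diff_derivable (Ck_diff Cf Oy)].
  by rewrite !fctE /= mulN1r -invfM -expr2.
Qed.

Lemma smooth_on_eq O f g : open O -> (forall y, O y -> f y = g y) ->
  smooth_on O f -> smooth_on O g.
Proof.
by move=> oO fg /smooth_onP Cf; apply/smooth_onP => m; exact: Ck_eq (Cf m).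
Qed.

Lemma smooth_on_cst O (r : R) : smooth_on O (cst r).
Proof. by apply/smooth_onP => m; exact: Ck_cst. Qed.

Lemma smooth_on_add O f g : open O -> smooth_on O f -> smooth_on O g ->
  smooth_on O (fun x => f x + g x).
Proof.
move=> oO /smooth_onP Cf /smooth_onP Cg.
by apply/smooth_onP => m; exact: Ck_add (Cf m) (Cg m).
Qed.

Lemma smooth_on_mul O f g : open O -> smooth_on O f -> smooth_on O g ->
  smooth_on O (fun x => f x * g x : R).
Proof.
move=> oO /smooth_onP Cf /smooth_onP Cg.
by apply/smooth_onP => m; exact: Ck_mul (Cf m) (Cg m).
Qed.

Lemma smooth_on_inv O f : open O -> (forall x, O x -> f x != 0) ->
  smooth_on O f -> smooth_on O (fun x => (f x : R)^-1).
Proof.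
move=> oO f0 /smooth_onP Cf.
by apply/smooth_onP => m; exact: Ck_inv (Cf m).
Qed.

Lemma smooth_on_opp O f : open O -> smooth_on O f ->
  smooth_on O (fun x => - (f x : R)).
Proof.
move=> oO sf; have sm := smooth_on_mul oO (smooth_on_cst (-1)) sf.
by apply: smooth_on_eq sm => // y _; rewrite /cst mulN1r.
Qed.

Lemma smooth_on_sum O (I : Type) (r : seq I) (F : I -> 'rV[R]_d -> R^o) :
  open O -> (forall i, smooth_on O (F i)) ->
  smooth_on O (fun x => \sum_(i <- r) F i x).
Proof.
move=> oO sF; elim: r => [|i r IH].
  by apply: (smooth_on_eq oO _ (smooth_on_cst 0)) => y _; rewrite big_nil.
by apply: (smooth_on_eq oO _ (smooth_on_add oO (sF i) IH)) => y _; rewrite big_cons.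
Qed.

Lemma smooth_on_prod O (I : Type) (r : seq I) (F : I -> 'rV[R]_d -> R^o) :
  open O -> (forall i, smooth_on O (F i)) ->
  smooth_on O (fun x => \prod_(i <- r) (F i x : R)).
Proof.
move=> oO sF; elim: r => [|i r IH].
  by apply: (smooth_on_eq oO _ (smooth_on_cst 1)) => y _; rewrite big_nil.
by apply: (smooth_on_eq oO _ (smooth_on_mul oO (sF i) IH)) => y _; rewrite big_cons.
Qed.

(** [smooth_on] is a condition on the germ of the total function at each point, so it can be checked
    on sets that cover [O]. *)
Lemma smooth_on_local O f :
  (forall x, O x -> exists2 U, U x & smooth_on U f) ->
  smooth_on O f.
Proof. by move=> H s x /H [U Ux]; apply. Qed.

(** Near each point [f] keeps its sign, and [|f|] is [f] or [- f] there. Interiors are taken to have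
    open sets on which the two functions agree. *)
Lemma smooth_on_norm O f : open O -> (forall x, O x -> f x != 0) ->
  smooth_on O f -> smooth_on O (fun x => `|f x : R|).
Proof.
move=> oO f0 sf.
have pos (h : 'rV[R]_d -> R^o) x : smooth_on O h -> O x -> 0 < (h x : R) ->
    nbhs x (O `&` [set y | 0 < (h y : R)]).
  move=> sh Ox hx; apply: filterI; first exact: (open_nbhs_nbhs (conj oO Ox)).
  have /differentiable_continuous hc := smooth_on_diff sh Ox.
  exact: (hc [set z | 0 < (z : R)] (lt_nbhsr hx)).
apply: smooth_on_local => x Ox.
have [fx|fx|fx] := ltgtP (f x : R) 0; last by have := f0 x Ox; rewrite fx eqxx.
- exists ((O `&` [set y | 0 < (- f y : R)])^°)%classic.
  + by apply: (pos (fun y => - f y)) => //; [exact: smooth_on_opp|rewrite oppr_gt0].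
  + apply: smooth_on_eq (smooth_onS _ (smooth_on_opp oO sf));
      [exact: open_interior| |].
      by move=> y /interior_subset [_ /=]; rewrite oppr_gt0 => /ltr0_norm ->.
    by move=> y /interior_subset [].
- exists ((O `&` [set y | 0 < (f y : R)])^°)%classic.
  + exact: pos.
  + apply: smooth_on_eq (smooth_onS _ sf); [exact: open_interior| |].
      by move=> y /interior_subset [_ /= fy]; rewrite gtr0_norm.
    by move=> y /interior_subset [].
Qed.

Lemma smooth_on_det O m (A : 'rV[R]_d -> 'M[R]_m) : open O ->
  (forall i j, smooth_on O (fun x => A x i j)) ->
  smooth_on O (fun x => \det (A x)).
Proof.
move=> oO sA.
apply: smooth_on_sum => // s; apply: smooth_on_mul => //.
  exact: smooth_on_cst.
by apply: smooth_on_prod.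
Qed.

(** Cramer's rule: the entries are cofactors divided by the determinant, and cofactors are
    determinants of minors up to sign. *)
Lemma smooth_on_invmx O m (A : 'rV[R]_d -> 'M[R]_m) : open O ->
  (forall i j, smooth_on O (fun x => A x i j)) ->
  (forall x, O x -> A x \in unitmx) ->
  forall i j, smooth_on O (fun x => invmx (A x) i j).
Proof.
move=> oO sA uA i j.
have sdet := smooth_on_det oO sA.
have adj : smooth_on O (fun x => \adj (A x) i j).
  have -> : (fun x => \adj (A x) i j) =
      (fun x => (-1) ^+ (j + i) * \det (row' j (col' i (A x)))).
    by apply/funext => x; rewrite mxE.
  apply: smooth_on_mul => //; first exact: smooth_on_cst.
  apply: smooth_on_det => // a b.
  by rewrite (_ : (fun x => _) = (fun x => A x (lift j a) (lift i b))) //;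
    apply/funext => x; rewrite !mxE.
have sinv : smooth_on O (fun x => (\det (A x))^-1).
  by apply: smooth_on_inv => // x /uA; rewrite unitmxE unitfE.
apply: (smooth_on_eq oO _ (smooth_on_mul oO sinv adj)) => y Oy.
by rewrite /invmx uA // [RHS]mxE.
Qed.

End SmoothCalculus.

(** * Functions in the charts of a manifold *)

Section Charts.
Context {R : realType} {d : nat} (M : manifold R d).
Implicit Types (V : set (pt M)) (f g : pt M -> R) (i j : chart M) (p : pt M).

(** Near [coord i p] the image is the preimage of [V] and [dom i] under [param i], which is
    continuous on the open image of the chart. *)
Lemma chart_open V i : open V -> open (coord i @` (V `&` dom i)).
Proof.
move=> oV; rewrite openE => _ [p [Vp ip] <-].
have pc : {for coord i p, continuous (@param _ _ M i)}.
  have := @param_continuous _ _ M i.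
  rewrite (continuous_open_subspace _ (@codom_open _ _ M i)); apply.
  by rewrite inE; exists p.
have oVi : open (V `&` dom i) by apply: openI => //; exact: dom_open.
have n1 : nbhs (coord i p) (param i @^-1` (V `&` dom i)).
  by apply: pc; apply: open_nbhs_nbhs; split => //; rewrite coordK.
have n2 : nbhs (coord i p) (coord i @` dom i).
  by apply: open_nbhs_nbhs; split; [exact: codom_open|exists p].
apply: filterS2 n1 n2 => x /= Vx [q iq qx]; rewrite -qx in Vx *.
by exists q => //; rewrite coordK in Vx.
Qed.

Lemma smooth_fun_on_diff V i f p : smooth_fun_on V i f -> V p -> dom i p ->
  differentiable (fun x => f (param i x) : R^o) (coord i p).
Proof. by move=> sf Vp ip; apply: (smooth_on_diff sf); exists p. Qed.

Lemma partial_eq V i a f g p : open V ->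
  (forall q, V q -> dom i q -> f q = g q) -> V p -> dom i p ->
  partial i a f p = partial i a g p.
Proof.
move=> oV fg Vp ip; apply: (pderiv_eq (O := coord i @` (V `&` dom i))).
- exact: chart_open.
- by move=> _ [q [Vq iq] <-]; rewrite coordK //; exact: fg.
- by exists p.
Qed.

Lemma partial_cst i a (r : R) p : partial i a (fun=> r) p = 0.
Proof. exact: derive_cst. Qed.

Lemma partialM V i a f g p : smooth_fun_on V i f -> smooth_fun_on V i g ->
  V p -> dom i p ->
  partial i a (fun q => f q * g q) p =
  f p * partial i a g p + g p * partial i a f p.
Proof.
move=> sf sg Vp ip; rewrite {1}/partial /pderiv.
rewrite [X in derive X _ _](_ : _ =
  (fun x => f (param i x)) * (fun x => g (param i x))) //.
rewrite deriveM ?coordK //; apply: diff_derivable.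
- exact: smooth_fun_on_diff sf Vp ip.
- exact: smooth_fun_on_diff sg Vp ip.
Qed.

Lemma partial_ln V i a f p : smooth_fun_on V i f -> V p -> dom i p -> 0 < f p ->
  partial i a (fun q => ln (f q)) p = (f p)^-1 * partial i a f p.
Proof.
move=> sf Vp ip fp.
have df := smooth_fun_on_diff sf Vp ip.
rewrite /partial /pderiv.
set F := fun x => f (param i x).
have Fp : F (coord i p) = f p by rewrite /F coordK.
have ln' : is_derive (F (coord i p)) (1 : R) (@ln R) (f p)^-1.
  by rewrite Fp; exact: is_derive1_ln.
have dln : differentiable (@ln R : R -> R^o) (F (coord i p)).
  by apply/derivable1_diffP; exact: ex_derive.
rewrite [X in derive X _ _](_ : _ = (@ln R : R -> R^o) \o F) //.
rewrite deriveE; last exact: differentiable_comp.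
rewrite diff_comp //= diff1E // derive1E derive_val.
by rewrite deriveE // [LHS]mulrC.
Qed.

Lemma smooth_fun_on_eq V i f g : open V ->
  (forall q, V q -> dom i q -> f q = g q) ->
  smooth_fun_on V i f -> smooth_fun_on V i g.
Proof.
move=> oV fg; apply: smooth_on_eq; first exact: chart_open.
by move=> _ [q [Vq iq] <-]; rewrite coordK //; exact: fg.
Qed.

Lemma smooth_fun_onS V V' i f : V' `<=` V ->
  smooth_fun_on V i f -> smooth_fun_on V' i f.
Proof.
by move=> VV; apply: smooth_onS => _ [q [/VV Vq iq] <-]; exists q.
Qed.

Lemma smooth_scalarS V V' f : V' `<=` V -> smooth_scalar V f -> smooth_scalar V' f.
Proof. by move=> VV sf i; exact: smooth_fun_onS (sf i). Qed.

Lemma smooth_fun_on_cst V i (r : R) : smooth_fun_on V i (fun=> r).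
Proof. exact: smooth_on_cst. Qed.

Lemma smooth_fun_onM V i f g : open V -> smooth_fun_on V i f ->
  smooth_fun_on V i g -> smooth_fun_on V i (fun q => f q * g q).
Proof. by move=> oV; apply: smooth_on_mul; exact: chart_open. Qed.

Lemma smooth_fun_onN V i f : open V -> smooth_fun_on V i f ->
  smooth_fun_on V i (fun q => - f q).
Proof. by move=> oV; apply: smooth_on_opp; exact: chart_open. Qed.

Lemma smooth_fun_on_sum V i (I : Type) (r : seq I) (F : I -> pt M -> R) :
  open V -> (forall k, smooth_fun_on V i (F k)) ->
  smooth_fun_on V i (fun q => \sum_(k <- r) F k q).
Proof.
move=> oV sF; rewrite /smooth_fun_on.
apply: (@smooth_on_sum R d _ I r (fun k x => F k (param i x))) => [|k].
  exact: chart_open.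
exact: sF.
Qed.

Lemma smooth_fun_onV V i f : open V -> (forall q, V q -> dom i q -> f q != 0) ->
  smooth_fun_on V i f -> smooth_fun_on V i (fun q => (f q)^-1).
Proof.
move=> oV f0; apply: smooth_on_inv; first exact: chart_open.
by move=> _ [q [Vq iq] <-]; rewrite coordK //; exact: f0.
Qed.

Lemma smooth_fun_on_norm V i f : open V -> (forall q, V q -> dom i q -> f q != 0) ->
  smooth_fun_on V i f -> smooth_fun_on V i (fun q => `|f q|).
Proof.
move=> oV f0; apply: smooth_on_norm; first exact: chart_open.
by move=> _ [q [Vq iq] <-]; rewrite coordK //; exact: f0.
Qed.

Lemma smooth_fun_on_partial V i a f : open V -> smooth_fun_on V i f ->
  smooth_fun_on V i (partial i a f).
Proof.
move=> oV sf; apply: smooth_on_eq (smooth_on_pderiv a sf).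
  exact: chart_open.
by move=> _ [q [Vq iq] <-]; rewrite /partial coordK.
Qed.

Lemma smooth_fun_on_ginv V i (g : metric M) : open V -> is_metric V g ->
  forall a b, smooth_fun_on V i (fun q => ginv g i q a b).
Proof.
move=> oV [_ ug sg _]; apply: smooth_on_invmx.
- exact: chart_open.
- exact: sg.
- by move=> _ [q [Vq iq] <-]; rewrite coordK //; exact: ug.
Qed.

(** Chain rule: near [coord i p], the expression of [f] in the chart [i] is its expression in the
    chart [j] composed with the transition map [phi]. *)
Lemma partial_jac i j a f p : dom i p -> dom j p ->
  differentiable (fun x => f (param j x) : R^o) (coord j p) ->
  partial i a f p = \sum_b jac i j p a b * partial j b f p.
Proof.
move=> ip jp df.
set x0 := coord i p; pose phi x := coord j (param i x).
pose F x : R^o := f (param j x).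
have phi0 : phi x0 = coord j p by rewrite /phi coordK.
have oij : open (coord i @` (dom j `&` dom i)) by apply: chart_open; exact: dom_open.
have x0ij : (coord i @` (dom j `&` dom i)) x0 by exists p.
have dphib b : differentiable (fun x => phi x 0 b : R^o) x0.
  have := @transition_smooth _ _ M i j b.
  by move=> /smooth_on_diff; apply; rewrite setIC.
have dphi : differentiable phi x0.
  have -> : phi = \sum_b (fun x => phi x 0 b *: delta_mx 0 b : 'rV[R]_d).
    by apply/funext => x; rewrite fct_sumE [LHS]row_sum_delta.
  by apply: differentiable_sum => b; exact: differentiableZl.
have -> : partial i a f p = 'D_(delta_mx 0 a) (F \o phi) x0.
  apply: (pderiv_eq _ oij) => // _ [q [jq iq] <-].
  by rewrite /F /phi /= coordK // coordK.
have dF : differentiable F (phi x0) by rewrite phi0.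
rewrite deriveE; last exact: differentiable_comp.
rewrite diff_comp //=.
have -> : 'd phi x0 (delta_mx 0 a) = \sum_b jac i j p a b *: delta_mx 0 b.
  rewrite -deriveE // derive_mx; last exact: diff_derivable.
  rewrite [LHS]row_sum_delta; apply: eq_bigr => b _; congr (_ *: _).
  by rewrite !mxE.
rewrite linear_sum; apply: eq_bigr => b _; rewrite linearZ; congr (_ * _).
by rewrite -deriveE // phi0.
Qed.

End Charts.

(** * Scales and densities *)

Section Scales.
Context {R : realType} {d : nat} {M : manifold R d}.
Variables (c : set (metric M)) (hc : conformal_class c).

Lemma class_scale g : c g -> is_scale c (Scale setT g).
Proof.
move=> cg; split=> /=; first exact: openT.
  by move: hc cg => [g0 _ ->] [].
exists g => //; exists (fun=> 1); first by move=> i; exact: smooth_fun_on_cst.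
by move=> p _; split=> // i _; rewrite expr1n scale1r.
Qed.

(** Both scales are compared at [p] with one generator [g0] of the class; the factor is the quotient
    of the two factors found. *)
Lemma scale_rescaled_at (g h : scale M) p :
  is_scale c g -> is_scale c h -> sdom g p -> sdom h p ->
  exists omega, rescaled_at p omega g h.
Proof.
have [g0 _ cE] := hc.
have base (k : scale M) : is_scale c k -> sdom k p -> exists omega : R,
    0 < omega /\ forall i, dom i p -> smet k i p = omega ^+ 2 *: g0 i p.
  move=> [_ _ [g1 cg1 [r1 _ h1]]] kp; move: cg1; rewrite cE => -[_ [r2 _ h2]].
  have [r1p e1] := h1 p kp; have [r2p e2] := h2 p I.
  exists (r1 p * r2 p); split=> [|i ip]; first exact: mulr_gt0.
  by rewrite e1 // e2 // scalerA exprMn.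
move=> sg sh gp hp; have [a [a0 ga]] := base g sg gp.
have [b [b0 hb]] := base h sh hp.
exists (b / a); split=> [|i ip]; first exact: divr_gt0.
rewrite hb // ga // scalerA expr_div_n divfK //.
by rewrite expf_neq0 // gt_eqF.
Qed.

Section Density.
Variables (sigma : scale M -> pt M -> R) (hs : is_density c 1 sigma).

Lemma density1_rescale (g h : scale M) p omega :
  is_scale c g -> is_scale c h -> sdom g p -> sdom h p ->
  rescaled_at p omega g h -> sigma h p = omega * sigma g p.
Proof.
move=> sg sh gp hp gh; have [_ /(_ g h p omega sg sh gp hp gh) ->] := hs.
by case: gh => omega0 _; rewrite powRr1 // ltW.
Qed.

Lemma zero_locusE (h : scale M) p : is_scale c h -> sdom h p ->
  zero_locus c sigma p <-> sigma h p = 0.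
Proof.
move=> sh hp; split=> [[g [sg gp s0]]|s0]; last by exists h.
have [omega gh] := scale_rescaled_at sg sh gp hp.
by rewrite (density1_rescale sg sh gp hp gh) s0 mulr0.
Qed.

Lemma density_smooth (h : scale M) : is_scale c h -> smooth_scalar (sdom h) (sigma h).
Proof. by case: hs => ds _; exact: ds. Qed.

Variables (g : metric M) (cg : c g).
Let W := ~` zero_locus c sigma.
Let go := einstein_scale c sigma g.
Let s := sigma (Scale setT g).

Let s_neq0 p : W p -> s p != 0.
Proof.
by move=> Wp; apply/eqP => s0; apply: Wp; apply/(zero_locusE (class_scale cg)).
Qed.

Lemma open_off_zero_locus : open W.
Proof.
rewrite openE => p Wp; have [i ip] := dom_cover p.
have sp := s_neq0 Wp.
have dsi := smooth_fun_on_diff (@density_smooth _ (class_scale cg) i) I ip.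
(* Smoothness of [s] is known only in coordinates, so its continuity at [p] is obtained by composing
   with a chart. *)
have cs : {for p, continuous (fun q => s (param i (coord i q)))}.
  apply: (@continuous_comp _ _ _ (@coord _ _ M i) (fun x => s (param i x))).
    have := @coord_continuous _ _ M i.
    by rewrite (continuous_open_subspace _ (@dom_open _ _ M i)); apply; rewrite inE.
  exact: (differentiable_continuous dsi).
have n1 : nbhs p [set q | s (param i (coord i q)) != 0].
  apply: (cs [set z | z != 0]); rewrite /= coordK //.
  by apply: open_nbhs_nbhs; split=> //; exact: open_neq.
have n2 : nbhs p (dom i) by apply: open_nbhs_nbhs; split=> //; exact: dom_open.
apply: filterS2 n1 n2 => q /= + iq; rewrite coordK // => sq Zq.
by move/eqP: sq; apply; apply/(zero_locusE (class_scale cg)).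
Qed.

Let smooth_s i : smooth_fun_on W i s.
Proof. exact: smooth_fun_onS (@density_smooth _ (class_scale cg) i). Qed.

(** This is the conformal factor from [g] to [go]: it has to be positive, hence the absolute value,
    and its square is [s ^- 2]. *)
Let smooth_omega : smooth_scalar W (fun p => `|s p|^-1).
Proof.
have oW := open_off_zero_locus.
move=> i; apply: smooth_fun_onV => // [q Wq _|]; first by rewrite normr_eq0 s_neq0.
by apply: smooth_fun_on_norm => // q Wq _; exact: s_neq0.
Qed.

Let goE i p : smet go i p = (`|s p|^-1) ^+ 2 *: g i p.
Proof. by rewrite /= -/s exprVn real_normK // num_real. Qed.

Lemma einstein_is_scale : is_scale c go.
Proof.
have oW := open_off_zero_locus.
have [_ [/= gsym gu gs gj] _] := class_scale cg.
split=> //; last first.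
  exists g => //; exists (fun p => `|s p|^-1) => // p Wp.
  split=> [|i ip]; last exact: goE.
  by rewrite invr_gt0 normr_gt0 s_neq0.
split=> [i p Wp ip|i p Wp ip|i a b|i j p Wp ip jp]; rewrite ?goE.
- by rewrite linearZ /= gsym.
- by rewrite unitmxZ ?gu // unitfE expf_neq0 // invr_eq0 normr_eq0 s_neq0.
- rewrite (_ : (fun p => _) = fun p => (`|s p|^-1 * `|s p|^-1) * g i p a b); last first.
    by apply/funext => p; rewrite goE mxE expr2.
  apply: smooth_fun_onM => //; last by apply: smooth_fun_onS (gs i a b).
  by apply: smooth_fun_onM.
- by rewrite (gj i j) // -scalemxAr -scalemxAl.
Qed.

(** By weight 1 the value in [go] is [s / |s|], the sign of [s], which need not be constant on
    [W]. *)
Lemma sigma_einstein_sq p : W p -> sigma go p ^+ 2 = 1.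
Proof.
move=> Wp.
have gr : rescaled_at p `|s p|^-1 (Scale setT g) go.
  by split=> [|i ip]; rewrite ?goE // invr_gt0 normr_gt0 s_neq0.
rewrite (density1_rescale (class_scale cg) einstein_is_scale _ _ gr) //.
rewrite -/s exprMn exprVn real_normK ?num_real // mulVf //.
by rewrite expf_neq0 // s_neq0.
Qed.

Lemma sigma_einstein_neq0 p : W p -> sigma go p != 0.
Proof.
move=> /sigma_einstein_sq s2; apply/eqP => s0.
by move/eqP: s2; rewrite s0 expr0n eq_sym oner_eq0.
Qed.

Lemma partial_sigma_einstein i a p : W p -> dom i p -> partial i a (sigma go) p = 0.
Proof.
move=> Wp ip; have oW := open_off_zero_locus.
have sm : smooth_fun_on W i (sigma go) := @density_smooth _ einstein_is_scale i.
(* differentiate [sigma ^ 2 = 1] *)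
have := partialM a sm sm Wp ip.
rewrite (@partial_eq _ _ _ W _ _ _ (fun=> 1)) // => [|q Wq iq]; last first.
  by rewrite -expr2 sigma_einstein_sq.
rewrite partial_cst -mulr2n => /esym/eqP.
by rewrite mulrn_eq0 mulf_eq0 /= (negPf (sigma_einstein_neq0 Wp)) => /eqP.
Qed.

(** The factor is positive and carries [sigma go], which is 1 or -1, to [sigma h]. *)
Lemma einstein_rescaled_at (h : scale M) p : is_scale c h -> W p -> sdom h p ->
  rescaled_at p `|sigma h p| go h.
Proof.
move=> sh Wp hp; have [omega gh] := scale_rescaled_at einstein_is_scale sh Wp hp.
rewrite (density1_rescale einstein_is_scale sh Wp hp gh) normrM.
have [om0 _] := gh; rewrite gtr0_norm //.
have /eqP := sigma_einstein_sq Wp.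
by rewrite sqrf_eq1 => /orP[] /eqP ->; rewrite ?normrN normr1 mulr1.
Qed.

End Density.
End Scales.

(** * The equations in the Einstein scale *)

Lemma set_nth_tnth (T : Type) (x0 : T) (s : seq T) (j : 'I_(size s)) :
  set_nth x0 s j (tnth (in_tuple s) j) = s.
Proof.
apply: (@eq_from_nth _ x0) => [|l _]; first by rewrite size_set_nth; apply/maxn_idPr.
by rewrite nth_set_nth /=; case: eqP => [->|//]; rewrite (tnth_nth x0).
Qed.

(** * Locality of the operators on an open set *)

Section Vanishing.
Context {R : realType} {d : nat} {M : manifold R d}.
Variables (g : metric M) (V : set (pt M)).
Implicit Types (S T : field M) (i : chart M) (p : pt M).

Lemma vanishes_fadd S T : vanishes_on V S -> vanishes_on V T ->
  vanishes_on V (fadd S T).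
Proof. by move=> vS vT i p s Vp ip; rewrite /fadd vS // vT // addr0. Qed.

Lemma vanishes_fsub S T : vanishes_on V S -> vanishes_on V T ->
  vanishes_on V (fsub S T).
Proof. by move=> vS vT i p s Vp ip; rewrite /fsub vS // vT // subr0. Qed.

Lemma vanishes_fscale r T : vanishes_on V T -> vanishes_on V (fscale r T).
Proof. by move=> vT i p s Vp ip; rewrite /fscale vT // mulr0. Qed.

Lemma vanishes_fmul f T : vanishes_on V T -> vanishes_on V (fmul f T).
Proof. by move=> vT i p s Vp ip; rewrite /fmul vT // mulr0. Qed.

Lemma vanishes_wedge T : vanishes_on V T -> vanishes_on V (wedge T).
Proof.
by move=> vT i p s Vp ip; rewrite /wedge big1 // => j _; rewrite vT // mulr0.
Qed.

Lemma vanishes_contract T : vanishes_on V T -> vanishes_on V (contract g T).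
Proof.
move=> vT i p s Vp ip; rewrite /contract big1 // => a _.
by rewrite big1 // => b _; rewrite vT // mulr0.
Qed.

Lemma vanishes_outerl u T : vanishes_on V u -> vanishes_on V (outer u T).
Proof. by move=> vu i p [|a s] Vp ip //=; rewrite vu // mul0r. Qed.

Lemma vanishes_outerr u T : vanishes_on V T -> vanishes_on V (outer u T).
Proof. by move=> vT i p [|a s] Vp ip //=; rewrite vT // mulr0. Qed.

Lemma vanishes_iotar u T : vanishes_on V T -> vanishes_on V (iota g u T).
Proof. by move=> vT; apply: vanishes_contract; exact: vanishes_outerr. Qed.

Lemma vanishes_eps u T : vanishes_on V T -> vanishes_on V (eps u T).
Proof. by move=> vT; apply: vanishes_wedge; exact: vanishes_outerr. Qed.

Lemma vanishes_iotal u T : vanishes_on V u -> vanishes_on V (iota g u T).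
Proof. by move=> vu; apply: vanishes_contract; exact: vanishes_outerl. Qed.

Lemma vanishes_JP T : vanishes_on V T -> vanishes_on V (JP g T).
Proof.
move=> vT; apply: vanishes_fsub; first exact: vanishes_fmul.
apply: vanishes_fscale => i p s Vp ip; rewrite /schouten_act big1 // => j _.
by rewrite big1 // => a _; rewrite vT // mulr0.
Qed.

Hypothesis openV : open V.

Lemma vanishes_nabla T : vanishes_on V T -> vanishes_on V (nabla g T).
Proof.
move=> vT i p [|a s] Vp ip //=.
rewrite (@partial_eq _ _ _ V _ _ _ (fun=> 0)) // => [|q Vq iq]; last exact: vT.
rewrite partial_cst big1 ?subr0 // => j _.
by rewrite big1 // => e _; rewrite vT // mulr0.
Qed.

Lemma vanishes_ext_d T : vanishes_on V T -> vanishes_on V (ext_d g T).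
Proof. by move=> vT; apply: vanishes_wedge; exact: vanishes_nabla. Qed.

Lemma vanishes_codiff T : vanishes_on V T -> vanishes_on V (codiff g T).
Proof. by move=> vT; apply: vanishes_contract; exact: vanishes_nabla. Qed.

Lemma vanishes_laplace T : vanishes_on V T -> vanishes_on V (laplace g T).
Proof.
by move=> vT; apply: vanishes_fadd;
  [apply: vanishes_ext_d; exact: vanishes_codiff
  |apply: vanishes_codiff; exact: vanishes_ext_d].
Qed.

Lemma vanishes_Dtr k w (F : slots (field M)) :
  all_slots (vanishes_on V) F -> all_slots (vanishes_on V) (Dtr g k w F).
Proof.
move=> [vN vW vE vS].
split; rewrite /Dtr /=.
- apply/vanishes_fscale/vanishes_fsub; first exact: vanishes_fscale.
  exact: vanishes_ext_d.
- exact/vanishes_fscale/vanishes_ext_d.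
- apply: vanishes_fadd; last first.
    apply/vanishes_fscale/vanishes_fadd; first exact: vanishes_ext_d.
    exact: vanishes_fscale.
  apply: vanishes_fsub; last exact/vanishes_fscale/vanishes_codiff.
  apply: vanishes_fadd; first exact: vanishes_laplace.
  exact/vanishes_fscale/vanishes_JP.
- apply: vanishes_fsub; last exact/vanishes_fscale/vanishes_ext_d.
  apply: vanishes_fsub; first apply: vanishes_fsub.
  + exact/vanishes_JP/vanishes_ext_d.
  + exact/vanishes_ext_d/vanishes_JP.
  + apply: vanishes_fadd; first exact: vanishes_laplace.
    exact/vanishes_fscale/vanishes_JP.
Qed.

(** The west slot is left out: with [nu = 0], [Istar] reads only the other three, since the west
    slot enters it through [iota nu]. *)
Lemma Dtr_west_only k w (F : slots (field M)) i p s : V p -> dom i p ->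
  vanishes_on V (north F) -> vanishes_on V (east F) -> vanishes_on V (south F) ->
  let wk := w + k%:~R in
  [/\ north (Dtr g k w F) i p s = (d%:R + 2 * w - 2) * (wk * west F i p s),
      east (Dtr g k w F) i p s = - (2 * codiff g (west F) i p s) &
      south (Dtr g k w F) i p s =
        - (laplace g (west F) i p s + wk * JP g (west F) i p s)].
Proof.
move=> Vp ip vN vE vS wk; split=> /=; rewrite /fscale /fadd /fsub.
- by rewrite [ext_d g (north F) i p s]vanishes_ext_d // subr0.
- rewrite [laplace g (north F) i p s]vanishes_laplace //.
  rewrite [JP g (north F) i p s]vanishes_JP //.
  rewrite [ext_d g (east F) i p s]vanishes_ext_d //.
  by rewrite [south F i p s]vS // !mulr0 !addr0 mulr0 add0r addr0.
- rewrite [JP g (ext_d g _) i p s]vanishes_JP //; last exact: vanishes_ext_d.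
  rewrite [ext_d g (JP g _) i p s]vanishes_ext_d //; last exact: vanishes_JP.
  rewrite [ext_d g (south F) i p s]vanishes_ext_d //.
  by rewrite mulr0 !subr0 add0r.
Qed.

Lemma nabla_of_fun (f : pt M -> R) i p s :
  nabla g (of_fun f) i p s = if s is [:: a] then partial i a f p else 0.
Proof.
case: s => [|a [|b s]] //=; first by rewrite big_ord0 subr0.
rewrite partial_cst sub0r big1 ?oppr0 // => -[[|j] /= ?] _;
  by rewrite big1 // => e _; rewrite mulr0.
Qed.

End Vanishing.

(** * Curvature and the tractor operators in the Einstein scale *)

Section EinsteinScale.
Context {R : realType} {d : nat} {M : manifold R d}.
Hypothesis dpos : (0 < d)%N.
Variables (c : set (metric M)) (hc : conformal_class c).
Variables (sigma : scale M -> pt M -> R) (hsigma : almost_einstein c sigma).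
Variables (g : metric M) (cg : c g).
Let W := ~` zero_locus c sigma.
Let go := einstein_scale c sigma g.
Let hs : is_density c 1 sigma := hsigma.1.
Let oW : open W := open_off_zero_locus hc hs cg.

Lemma grad_einstein : vanishes_on W (grad go (sigma go)).
Proof.
move=> i p s Wp ip; rewrite /grad nabla_of_fun.
by case: s => [|a [|]] //; exact: partial_sigma_einstein.
Qed.

Lemma rho_einstein i p : W p -> dom i p ->
  rho go (sigma go) i p = - (d%:R^-1 * (J go i p * sigma go p)).
Proof.
move=> Wp ip; rewrite /rho (@vanishes_codiff _ _ _ go W) ?add0r //.
exact: grad_einstein.
Qed.

Lemma schouten_einstein i p : W p -> dom i p ->
  schouten go i p = (d%:R^-1 * J go i p) *: smet go i p.
Proof.
move=> Wp ip; apply/matrixP => a b; rewrite [RHS]mxE.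
have [_ /(_ go (einstein_is_scale hc hs cg) i p Wp ip)] := hsigma.
move=> [_ /(_ a b) + _]; rewrite [LHS](@vanishes_nabla _ _ _ go W) //; last first.
  exact: grad_einstein.
rewrite rho_einstein // mulNr opprK addrC => /esym/eqP; rewrite subr_eq0 => /eqP.
rewrite mulrA mulrAC [RHS]mulrC => /(mulIf (sigma_einstein_neq0 hc hs cg Wp)) <-.
by [].
Qed.

(** [P^a_b] is [J / d] times the identity, and the identity extended as a derivation multiplies by
    the number of indices. *)
Lemma schouten_act_einstein T i p s : W p -> dom i p ->
  schouten_act go T i p s = d%:R^-1 * J go i p * (size s)%:R * T i p s.
Proof.
move=> Wp ip; rewrite /schouten_act.
have [_ [_ gu _ _] _] := einstein_is_scale hc hs cg.
have -> : ginv go i p *m schouten go i p = (d%:R^-1 * J go i p)%:M.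
  rewrite schouten_einstein // -scalemxAr mulVmx ?scalemx1 //; exact: gu.
under eq_bigr => j _.
  rewrite (bigD1 (tnth (in_tuple s) j)) //= big1 ?addr0; last first.
    by move=> a aj; rewrite mxE (negPf aj) mul0r.
  rewrite mxE eqxx mulr1n.
  rewrite (_ : set_nth _ s j _ = s); last first.
    exact: set_nth_tnth.
  over.
by rewrite sumr_const card_ord -[LHS]mulr_natr [LHS]mulrAC.
Qed.

Lemma Istar_einstein F i p s : W p -> dom i p ->
  let I := Istar go (sigma go) F in
  [/\ north I i p s = - (sigma go p * east F i p s),
      west I i p s = rho go (sigma go) i p * north F i p s
                     + sigma go p * south F i p s,
      east I i p s = 0 &
      south I i p s = rho go (sigma go) i p * east F i p s].
Proof.
move=> Wp ip I; have i0 T := vanishes_iotal go T grad_einstein s Wp ip.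
split; rewrite /I /Istar /= /fadd /fsub /fopp /fmul ?i0 //.
- by rewrite oppr0 sub0r.
- by rewrite addr0.
- by rewrite subr0.
Qed.

Section Equations.
Variables (k : nat) (w : R) (F : slots (field M)).
Hypotheses (vN : vanishes_on W (north F)) (vE : vanishes_on W (east F))
  (vS : vanishes_on W (south F)).
Hypothesis hA : forall i p s, size s != k -> west F i p s = 0.

(** The factor [d - 1] is the [n] of the mass formula. *)
Let m2 : scal M := fun i p =>
  - (2 * J go i p / d%:R) * (w + k%:R) * (d%:R - 1 + w - k%:R).

Lemma ytr_einstein i p s : W p -> dom i p ->
  let y := ytr go (sigma go) k w F in
  [/\ north y i p s = - (sigma go p * (2 * codiff go (west F) i p s)),
      west y i p s = sigma go p * (laplace go (west F) i p s
                                   - m2 i p * west F i p s),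
      east y i p s = 0 &
      south y i p s = rho go (sigma go) i p * (2 * codiff go (west F) i p s)].
Proof.
move=> Wp ip y.
have [N1 W1 E1 S1] := Istar_einstein (Dtr go k w F) s Wp ip.
have [N2 E2 S2] := Dtr_west_only go oW k w s Wp ip vN vE vS.
have : all_slots (vanishes_on W) (Istar go (sigma go) F).
  split=> j q t Wq jq; have [eN eW eE eS] := Istar_einstein F t Wq jq;
  by rewrite ?eN ?eW ?eE ?eS ?vN ?vE ?vS // ?mulr0 ?oppr0 ?addr0.
(* [Istar F] vanishes on the open set [W], hence so does [Dtr] of it: this disposes of the second
   half of [ytr]. *)
move=> /(vanishes_Dtr go oW (k%:Z - 1) w) [vn vw ve vs].
rewrite E2 mulrN opprK in N1; rewrite N2 S2 in W1; rewrite E2 in S1.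
rewrite /y /ytr; move: N1 W1 E1 S1 vn vw ve vs.
move: (Istar _ _ (Dtr _ _ _ _)) (Dtr _ _ _ (Istar _ _ _)) => A B.
move=> N1 W1 E1 S1 vn vw ve vs.
split; rewrite /= /fopp /fadd ?vn ?vw ?ve ?vs // ?addr0.
- by rewrite N1.
- rewrite W1 rho_einstein // /JP /fsub /fmul /fscale schouten_act_einstein //.
  (* The Schouten action multiplies by [size s], which is the degree [k] exactly where the form can
     be nonzero. *)
  have [sk|/hA ->] := eqVneq (size s) k; last first.
    by rewrite !mulr0 !subr0 !mulr0 !addr0; ring.
  rewrite sk /m2 /intmul.
  field.
  by rewrite pnatr_eq0 -lt0n.
- by rewrite E1 oppr0.
- by rewrite S1 mulrN opprK.
Qed.

(** [Dhat_star] gives [codiff A = 0] on an open set, so [ext_d (codiff A)] vanishes too and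
    [laplace] reduces to [codiff (ext_d A)]. Conversely, the north and south slots of [ytr] are
    multiples of [codiff A]. *)
Lemma proca_einstein :
  all_slots (vanishes_on W) (ytr go (sigma go) k w F) /\
  all_slots (vanishes_on W) (Dhat_star go k w F) <->
  vanishes_on W (fsub (codiff go (ext_d go (west F))) (fmul m2 (west F))) /\
  vanishes_on W (codiff go (west F)).
Proof.
split=> [[[_ vyW _ _] [_ vD _ _]]|[vP vc]].
  have vc : vanishes_on W (codiff go (west F)).
    move=> i p s Wp ip; have := vD i p s Wp ip.
    by rewrite /= /fadd /fscale vS // mulr0 addr0.
  split=> // i p s Wp ip.
  have [_ yW _ _] := ytr_einstein s Wp ip; move: yW; rewrite vyW // => /esym/eqP.
  rewrite mulf_eq0 (negPf (sigma_einstein_neq0 hc hs cg Wp)) /= => /eqP.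
  by rewrite /laplace /fadd [ext_d go _ i p s](vanishes_ext_d go oW vc) // add0r.
split; split=> // i p s Wp ip.
- by have [-> _ _ _] := ytr_einstein s Wp ip; rewrite vc // !mulr0 oppr0.
- have [_ -> _ _] := ytr_einstein s Wp ip.
  rewrite /laplace /fadd [ext_d go _ i p s](vanishes_ext_d go oW vc) // add0r.
  by have := vP i p s Wp ip; rewrite /fsub /fmul => ->; rewrite mulr0.
- by have [_ _ -> _] := ytr_einstein s Wp ip.
- by have [_ _ _ ->] := ytr_einstein s Wp ip; rewrite vc // !mulr0.
- by rewrite /= /fadd /fscale vS // mulr0 addr0 vc.
- by rewrite /= /fopp (vanishes_codiff go oW vS) // oppr0.
Qed.

End Equations.
End EinsteinScale.

(** * Weighted forms *)

Section Pull.
Context {R : realType} {d : nat} {M : manifold R d}.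

Lemma pull_sum (D : 'M[R]_d) (I : Type) (r : seq I) (T : I -> seq 'I_d -> R) s :
  pull D (fun t => \sum_(l <- r) T l t) s = \sum_(l <- r) pull D (T l) s.
Proof.
elim: s T => [|a s IH] T //=.
under eq_bigr do rewrite IH mulr_sumr.
exact: exchange_big.
Qed.

Lemma pull_scale (D : 'M[R]_d) (x : R) (T : seq 'I_d -> R) s :
  pull D (fun t => x * T t) s = x * pull D T s.
Proof.
elim: s T => [|a s IH] T //=; rewrite mulr_sumr.
by apply: eq_bigr => b _; rewrite IH mulrCA.
Qed.

Lemma iotaE (g : metric M) (u T : field M) i p s :
  iota g u T i p s =
  \sum_a \sum_b ginv g i p a b * (u i p [:: a] * T i p (b :: s)).
Proof. by []. Qed.

(** The metric itself inverts the Jacobian [K]: the transformation law of [g] gives [K] a right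
    inverse, which for square matrices is also a left inverse. *)
Lemma ginv_jac (V : set (pt M)) (g : metric M) i j p :
  is_metric V g -> V p -> dom i p -> dom j p ->
  ginv g j p = (jac i j p)^T *m ginv g i p *m jac i j p.
Proof.
move=> [_ gu _ gj] Vp ip jp; rewrite /ginv.
have gE := gj i j p Vp ip jp; set K := jac i j p in gE *.
have ui := gu i p Vp ip; have uj := gu j p Vp jp.
have : K *m (g j p *m K^T *m invmx (g i p)) = 1%:M.
  by rewrite !mulmxA -gE mulmxV.
move=> /mulmx1C e; rewrite -[RHS]mul1mx -(mulVmx uj) -[RHS]mulmxA.
by rewrite !mulmxA in e *; rewrite -!mulmxA in e *; rewrite e mulmx1.
Qed.

(** Both sides expand to the same fourfold sum; [ginv_jac] absorbs the Jacobians of [u] and of the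
    contracted index of [T]. *)
Lemma iota_pull (V : set (pt M)) (g : metric M) (u T : field M) i j p s :
  is_metric V g -> V p -> dom i p -> dom j p ->
  (forall a, u i p [:: a] = \sum_b jac i j p a b * u j p [:: b]) ->
  (forall b, T i p (b :: s) = pull (jac i j p) (T j p) (b :: s)) ->
  iota g u T i p s = pull (jac i j p) (iota g u T j p) s.
Proof.
move=> mg Vp ip jp eu eT.
rewrite [in RHS](_ : iota g u T j p = fun s => \sum_a \sum_b
  ginv g j p a b * (u j p [:: a] * T j p (b :: s))); last by apply/funext.
set K := jac i j p in eu eT *; pose G := ginv g i p.
pose v e := u j p [:: e]; pose X e := pull K (fun t => T j p (e :: t)) s.
transitivity (\sum_a \sum_b \sum_e \sum_f
    G a b * (K a e * v e * (K b f * X f))).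
  rewrite [LHS]iotaE; apply: eq_bigr => a _; apply: eq_bigr => b _.
  rewrite eu eT /= mulr_suml mulr_sumr; apply: eq_bigr => e _.
  by rewrite !mulr_sumr.
rewrite pull_sum; transitivity (\sum_e \sum_f \sum_b \sum_a
    G a b * (K a e * v e * (K b f * X f))).
  rewrite exchange_big /=; under eq_bigr => b _.
    rewrite exchange_big /=; under eq_bigr do rewrite exchange_big /=; over.
  rewrite exchange_big /=; apply: eq_bigr => e _.
  by rewrite exchange_big.
apply: eq_bigr => e _; rewrite pull_sum; apply: eq_bigr => f _.
rewrite 2!pull_scale (ginv_jac mg Vp ip jp) [(_ *m _ *m _) _ _]mxE mulr_suml.
apply: eq_bigr => b _; rewrite [(_ *m _) _ _]mxE !mulr_suml.
apply: eq_bigr => a _; rewrite [(_^T)%R _ _]mxE -/K -/G -/(v e) -/(X f); ring.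
Qed.

End Pull.

(** * Weighted forms: determination by one scale, restriction, contraction with [d log f] *)

Section WeightedForms.
Context {R : realType} {d : nat} {M : manifold R d}.
Variables (c : set (metric M)) (hc : conformal_class c).
Implicit Types (V U : set (pt M)) (w : R) (mu : wform M).

Lemma wform0 V (k : int) w : is_wform c V k w (fun=> @fzero R d M).
Proof.
split=> // [g sg|g h p om sg sh Vp gp hp gh i s ip]; last by rewrite mulr0.
split=> // [i p s t a b|i s|i j p s _ _ _]; first by rewrite /fzero oppr0.
  exact: smooth_fun_on_cst.
rewrite /fzero; elim: s => //= a s IH; rewrite big1 // => b _.
by rewrite -IH mulr0.
Qed.

Lemma wform_size V (k : nat) w mu g i p s : is_wform c V k w mu ->
  size s != k -> mu g i p s = 0.
Proof.
move=> [m0 mf _] sk; have [sg|/m0 -> //] := pselect (is_scale c g).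
by have [_ hk _ _ _] := mf g sg; apply: hk.
Qed.

Lemma wform_off V (k : int) w mu g i p s : is_wform c V k w mu ->
  ~ V p -> mu g i p s = 0.
Proof.
move=> [m0 mf _] Vp; have [sg|/m0 -> //] := pselect (is_scale c g).
by have [h0 _ _ _ _] := mf g sg; apply: h0 => -[[]].
Qed.

(** The weight law carries the values from [h] to any other scale. Off the domain, and for
    non-scales, both sides are 0 by convention, whence an equality of functions. *)
Lemma wform_ext V (k : int) w mu nu (h : scale M) : is_scale c h ->
  V `<=` sdom h -> is_wform c V k w mu -> is_wform c V k w nu ->
  (forall i p s, V p -> dom i p -> mu h i p s = nu h i p s) -> mu = nu.
Proof.
move=> sh Vh [m0 mf mw] [n0 nf nw] mn; apply/funext => g.
have [sg|sg] := pselect (is_scale c g); last by rewrite m0 // n0.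
apply/funext => i; apply/funext => p; apply/funext => s.
have [[[Vp gp] ip]|nVp] := pselect ((V `&` sdom g) p /\ dom i p); last first.
  by have [-> // _ _ _ _] := mf g sg; have [-> // _ _ _ _] := nf g sg.
have hp := Vh _ Vp; have [om hg] := scale_rescaled_at hc sh sg hp gp.
by rewrite (mw h g p om) // (nw h g p om) // mn.
Qed.

(** The slots of a tractor form in a scale [h] must be 0 off [sdom h], so a form over [W] has to be
    cut down before it can serve as a slot. *)
Definition wrestrict U mu : wform M :=
  fun g i p s => if `[< U p >] then mu g i p s else 0.

Lemma wform_wrestrict V U (k : int) w mu : open V -> open U ->
  is_wform c V k w mu -> is_wform c (V `&` U) k w (wrestrict U mu).
Proof.
move=> oV oU [m0 mf mw]; rewrite /wrestrict; split.
- move=> g sg; apply/funext => i; apply/funext => p; apply/funext => s.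
  by rewrite m0 // /fzero if_same.
- move=> g sg; have [og _ _] := sg.
  have sub : V `&` U `&` sdom g `<=` V `&` sdom g by move=> p [[]].
  have [f0 fk fa fs fj] := mf g sg; split.
  + move=> i p s nV; case: asboolP => // Up; apply: f0 => -[[Vp gp] ip].
    by apply: nV.
  + by move=> i p s sk; rewrite fk // if_same.
  + by move=> i p s t a b; case: asboolP => [_|_]; rewrite ?oppr0 // fa.
  + move=> i s; apply: smooth_fun_on_eq (smooth_fun_onS sub (fs i s)).
      by do !apply: openI.
    by move=> q [[_ Uq] _] _; case: asboolP.
  + move=> i j p s [[Vp Up] gp] ip jp; case: asboolP => // _.
    exact: fj.
- move=> g h p om sg sh [Vp Up] gp hp gh i s ip.
  by case: asboolP => // _; exact: mw.
Qed.

Lemma ginv_rescaled (g h : scale M) i p om :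
  rescaled_at p om g h -> dom i p -> smet g i p \in unitmx ->
  ginv h i p = om ^- 2 *: ginv g i p.
Proof.
move=> [om0 gh] ip ug; rewrite /ginv gh // invmxZ //.
by rewrite unitmxZ // unitfE expf_neq0 // gt_eqF.
Qed.

(** Minus the interior product by [d log f]. *)
Definition iota_dlog (f : pt M -> R) mu : wform M :=
  fun g i p s => - (f p)^-1 * iota g (nabla g (of_fun f)) (mu g) i p s.

(** Here [f] is a fixed function, so [d log f] is an ordinary 1-form of weight 0, and the weight
    drops by 2 through [ginv] alone. *)
Lemma wform_iota_dlog V (k : int) w mu f : open V -> smooth_scalar V f ->
  (forall p, V p -> f p != 0) ->
  is_wform c V k w mu -> is_wform c V (k - 1) (w - 2) (iota_dlog f mu).
Proof.
move=> oV sf f0 [m0 mf mw]; rewrite /iota_dlog.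
have E (g : scale M) i p s : iota g (nabla g (of_fun f)) (mu g) i p s =
    \sum_a \sum_b ginv g i p a b * (partial i a f p * mu g i p (b :: s)).
  rewrite iotaE; apply: eq_bigr => a _; apply: eq_bigr => b _.
  by rewrite nabla_of_fun.
have z (g : scale M) i p s : (forall b, mu g i p (b :: s) = 0) ->
    - (f p)^-1 * iota g (nabla g (of_fun f)) (mu g) i p s = 0.
  move=> hz; rewrite E big1 ?mulr0 // => a _.
  by rewrite big1 // => b _; rewrite hz !mulr0.
split.
- move=> g sg; apply/funext => i; apply/funext => p; apply/funext => s.
  by rewrite z // => b; rewrite m0.
- move=> g sg; have [og mg _] := sg.
  have oVg : open (V `&` sdom g) by exact: openI.
  have [h0 hk ha hs hj] := mf g sg; split.
  + by move=> i p s nV; apply: z => b; exact: h0.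
  + move=> i p s sk; apply: z => b; apply: hk.
    apply: contra sk => /eqP <-; apply/eqP => /=.
    by rewrite -addn1 PoszD addrK.
  + move=> i p s t a b; rewrite -mulrN; congr (_ * _).
    rewrite !E -sumrN; apply: eq_bigr => e _; rewrite -sumrN.
    by apply: eq_bigr => e' _; rewrite -!mulrN -(ha i p (e' :: s)).
  + move=> i s; apply: smooth_fun_onM => //.
      apply: smooth_fun_onN => //.
      apply: smooth_fun_onV => //; first by move=> q [/f0].
      by apply: smooth_fun_onS (sf i) => q [].
    apply: smooth_fun_on_eq
      (_ : smooth_fun_on _ i (fun p => \sum_a \sum_b ginv g i p a b *
        (partial i a f p * mu g i p (b :: s)))) => //.
    apply: smooth_fun_on_sum => // a; apply: smooth_fun_on_sum => // b.
    apply: smooth_fun_onM => //.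
      by apply: (smooth_fun_onS _ (smooth_fun_on_ginv og mg a b)) => q [].
    apply: smooth_fun_onM => //.
    by apply: (smooth_fun_onS _ (smooth_fun_on_partial a oV (sf i))) => q [].
  + move=> i j p s [Vp gp] ip jp; rewrite pull_scale; congr (_ * _).
    apply: (iota_pull mg gp ip jp) => [a|b]; last exact: hj.
    rewrite nabla_of_fun; under eq_bigr do rewrite nabla_of_fun.
    by apply: partial_jac => //; exact: smooth_fun_on_diff (sf j) Vp jp.
- move=> g h p om sg sh Vp gp hp gh i s ip.
  have [_ [_ gu _ _] _] := sg; have [om0 _] := gh.
  rewrite mulrCA; congr (_ * _); rewrite !E mulr_sumr; apply: eq_bigr => a _.
  rewrite mulr_sumr; apply: eq_bigr => b _.
  rewrite (mw g h p om) // (ginv_rescaled gh ip (gu i p gp ip)) mxE.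
  rewrite powRB ?(gt_eqF om0) ?implybT // -[2]/(2%:R) powR_mulrn ?ltW //.
  ring.
Qed.

End WeightedForms.

(** * Extension of a solution to a tractor form *)

Section TractorLift.
Context {R : realType} {d : nat} {M : manifold R d}.
Variables (c : set (metric M)) (hc : conformal_class c).
Variables (sigma : scale M -> pt M -> R) (hs : is_density c 1 sigma).
Variables (g0 : metric M) (cg : c g0) (k : nat) (w : R).
Let W := ~` zero_locus c sigma.
Let go := einstein_scale c sigma g0.
Let oW : open W := open_off_zero_locus hc hs cg.
Let sgo : is_scale c go := einstein_is_scale hc hs cg.

(** The south slot is the one that makes [Istar] vanish in every scale. *)
Definition proca_lift (A : wform M) : tractor M := fun h =>
  if `[< is_scale c h >] then
    Slots (fun=> @fzero R d M) (wrestrict (sdom h) A) (fun=> @fzero R d M)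
          (iota_dlog (sigma h) (wrestrict (sdom h) A))
  else Slots (fun=> @fzero R d M) (fun=> @fzero R d M)
             (fun=> @fzero R d M) (fun=> @fzero R d M).

Lemma proca_liftE A h : is_scale c h -> proca_lift A h =
  Slots (fun=> @fzero R d M) (wrestrict (sdom h) A) (fun=> @fzero R d M)
        (iota_dlog (sigma h) (wrestrict (sdom h) A)).
Proof. by move=> sh; rewrite /proca_lift; case: asboolP. Qed.

Lemma sigma_neq0 (h : scale M) p : is_scale c h -> W p -> sdom h p -> sigma h p != 0.
Proof. by move=> sh Wp hp; apply/eqP => /(zero_locusE hc hs sh hp). Qed.

(** Logarithmic derivative of [sigma h = Omega * sigma g]. Only the positive factor [Omega] goes
    through [ln], as [sigma] may be negative. *)
Lemma dlog_rescale (g h : scale M) Omega i a p :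
  is_scale c g -> is_scale c h ->
  let V := W `&` sdom g `&` sdom h in
  smooth_scalar V Omega ->
  (forall q, V q -> rescaled_at q (Omega q) g h) ->
  V p -> dom i p ->
  (sigma h p)^-1 * partial i a (sigma h) p =
  (sigma g p)^-1 * partial i a (sigma g) p
  + partial i a (fun q => ln (Omega q)) p.
Proof.
move=> sg sh V sO gh Vp ip.
have [[Wp gp] hp] := Vp; have [Op _] := gh p Vp.
have [[og _ _] [oh _ _]] := (sg, sh).
have oV : open V by do 2?apply: openI.
have sgp := sigma_neq0 sg Wp gp.
have E q : V q -> sigma h q = Omega q * sigma g q.
  move=> Vq; have [[Wq gq] hq] := Vq.
  exact: (density1_rescale hs sg sh gq hq (gh q Vq)).
rewrite (partial_ln a (sO i) Vp ip Op) E //.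
rewrite (@partial_eq _ _ _ V i a _ (fun q => Omega q * sigma g q)) //; last first.
  by move=> q Vq _; exact: E.
have smg : smooth_fun_on V i (sigma g).
  by apply: (smooth_fun_onS _ (@density_smooth _ _ _ _ _ hs _ sg i)) => q [[]].
rewrite (partialM a (sO i) smg Vp ip).
by field; rewrite sgp gt_eqF.
Qed.

(** With north and east slots zero, [change] fixes the west slot and adds [- iota (d log Omega) A]
    to the south slot; [dlog_rescale] gives exactly this increment. *)
Lemma proca_lift_tractor A :
  is_wform c W k (w + k%:R) A -> is_tractor c W k w (proca_lift A).
Proof.
move=> wA; split.
- by move=> h sh; rewrite /proca_lift; case: asboolP.
- move=> h sh; rewrite proca_liftE //=; have [oh _ _] := sh.
  have wc := wform_wrestrict oW oh wA.
  split; [exact: wform0|exact: wc|exact: wform0|].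
  apply: (wform_iota_dlog _ _ _ wc); first exact: openI.
    by apply: (smooth_scalarS _ (density_smooth hs sh)) => q [].
  by move=> q [Wq hq]; exact: sigma_neq0.
- move=> g h Omega sg sh V sO gh; rewrite !proca_liftE //=.
  have v0 : vanishes_on V (@fzero R d M) by [].
  have i0 u := vanishes_iotar g u v0; have e0 u := vanishes_eps u v0.
  split=> i p s Vp ip.
  + by rewrite /fsub subrr.
  + have [[Wp gp] hp] := Vp.
    rewrite /fsub /fadd [eps _ _ _ _ _]e0 // addr0 /wrestrict.
    by case: asboolP => // _; case: asboolP => // _; rewrite subrr.
  + by rewrite /fsub [iota _ _ _ _ _ _]i0 // !subr0.
  + have [[Wp gp] hp] := Vp.
    rewrite /= {1 2 3 4}/fsub /fadd /fscale /fsub.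
    rewrite [iota g _ (eps _ _) _ _ _](vanishes_iotar g _ (e0 _)) //.
    rewrite [eps _ (iota _ _ _) _ _ _](vanishes_eps _ (i0 _)) //.
    rewrite [eps _ _ _ _ _]e0 // subrr mulr0 addr0 subr0.
    apply/eqP; rewrite subr_eq0; apply/eqP.
    rewrite /iota_dlog !iotaE !mulr_sumr -sumrB; apply: eq_bigr => a _.
    rewrite !mulr_sumr -sumrB; apply: eq_bigr => b _.
    rewrite !nabla_of_fun /wrestrict; case: asboolP => // _; case: asboolP => // _.
    have := dlog_rescale a sg sh sO gh Vp ip.
    set x := (sigma h p)^-1; set y := (sigma g p)^-1 => e.
    transitivity (- ginv g i p a b * A g i p (b :: s) *
      (x * partial i a (sigma h) p)); first by ring.
    by rewrite e; ring.
Qed.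

End TractorLift.

(** * The bijection between the two solution spaces *)

Section Bijection.
Context {R : realType} {d : nat} {M : manifold R d}.
Hypothesis dpos : (0 < d)%N.
Variables (c : set (metric M)) (hc : conformal_class c).
Variables (sigma : scale M -> pt M -> R) (hsigma : almost_einstein c sigma).
Variables (g0 : metric M) (cg : c g0) (k : nat) (w : R).
Let W := ~` zero_locus c sigma.
Let go := einstein_scale c sigma g0.
Let hs : is_density c 1 sigma := hsigma.1.
Let oW : open W := open_off_zero_locus hc hs cg.
Let sgo : is_scale c go := einstein_is_scale hc hs cg.
Let m2 : scal M := fun i p =>
  - (2 * J go i p / d%:R) * (w + k%:R) * (d%:R - 1 + w - k%:R).

Lemma tractor_proca_slots F : tractor_proca c sigma W go k w F ->
  triv go (F go) =
  Slots (@fzero R d M) (west (F go) go) (@fzero R d M) (@fzero R d M).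
Proof.
move=> [[_ tw _] [_ _ [_ vN _ vE] [_ vI _ _]]].
have [wN _ wE wS] := tw go sgo.
(* Forms are 0 off their domain, so vanishing on [W] becomes equality of functions, which can be
   substituted in the equations. *)
have full (l : int) v mu : is_wform c (W `&` sdom go) l v mu ->
    vanishes_on W (mu go) -> mu go = @fzero R d M.
  move=> wm vm; apply/funext => i; apply/funext => p; apply/funext => s.
  have [_ /(_ go sgo) [f0 _ _ _ _] _] := wm.
  have [[Wp ip]|nWp] := pselect (W p /\ dom i p); first exact: vm.
  by apply: f0 => -[[[Wp _] _] ip]; apply: nWp.
rewrite /triv /map_slots (full _ _ _ wN vN) (full _ _ _ wE vE).
rewrite (full _ _ _ wS) // => i p s Wp ip; have := vI i p s Wp ip.
have [_ -> _ _] := Istar_einstein hc hsigma cg (triv go (F go)) s Wp ip.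
rewrite [north _ _ _ _](vN i p s Wp ip) mulr0 add0r => /eqP.
by rewrite mulf_eq0 (negPf (sigma_einstein_neq0 hc hs cg Wp)) => /eqP.
Qed.

Lemma tractor_proca_proca F : tractor_proca c sigma W go k w F ->
  proca c W go k (w + k%:R) m2 (west (F go)).
Proof.
move=> tF; have FE := tractor_proca_slots tF.
case: tF => [[_ /(_ go sgo) [_ wA _ _] _] [vy vD _ _]].
rewrite !setIid in wA; split=> //.
have hA i p s : size s != k -> west (triv go (F go)) i p s = 0.
  exact: wform_size wA.
rewrite FE in vy vD hA.
have v0 : vanishes_on W (@fzero R d M) by [].
have [H _] := proca_einstein dpos hc hsigma cg w (F := Slots _ _ _ _) v0 v0 v0 hA.
by case: (H (conj vy vD)).
Qed.

(** [change] expresses the slots for [h], trivialised in [go], through the common slots for [go].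
    This asks for a smooth positive factor from [go] to [h], namely [|sigma h|]; [wform_ext] then
    passes from [go] to all trivialisations. *)
Lemma tractor_proca_inj F G : tractor_proca c sigma W go k w F ->
  tractor_proca c sigma W go k w G -> west (F go) = west (G go) -> F = G.
Proof.
move=> tF tG FG; have FE := tractor_proca_slots tF.
have := tractor_proca_slots tG; rewrite -FG -FE => GE.
case: tF tG => [[F0 Fw Ft] _] [[G0 Gw Gt] _].
apply/funext => h; have [sh|sh] := pselect (is_scale c h); last first.
  case: (F h) (G h) (F0 h sh) (G0 h sh) => a b e f [a' b' e' f'] /=.
  by move=> [/= -> -> -> ->] [/= -> -> -> ->].
have Vgo : W `&` sdom h `<=` sdom go by move=> p [].
have VE p : (W `&` sdom h) p -> (W `&` sdom go `&` sdom h) p by move=> [].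
have sm : smooth_scalar (W `&` sdom go `&` sdom h) (fun p => `|sigma h p|).
  have [oh _ _] := sh; have [ogo _ _] := sgo.
  move=> i; apply: smooth_fun_on_norm.
  - by do 2?apply: openI.
  - by move=> q [[Wq _] hq] _; exact: (sigma_neq0 hc hs sh Wq hq).
  - by apply: (smooth_fun_onS _ (@density_smooth _ _ _ _ _ hs _ sh i)) => q [].
have rs p : (W `&` sdom go `&` sdom h) p -> rescaled_at p `|sigma h p| go h.
  by move=> [[Wp _] hp]; exact: einstein_rescaled_at.
have [fN fW fE fS] := Ft go h _ sgo sh sm rs.
have [gN gW gE gS] := Gt go h _ sgo sh sm rs.
rewrite GE in gN gW gE gS.
have eq_of (S T U : field M) :
    vanishes_on (W `&` sdom go `&` sdom h) (fsub S U) ->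
    vanishes_on (W `&` sdom go `&` sdom h) (fsub T U) ->
    forall i p s, (W `&` sdom h) p -> dom i p -> S i p s = T i p s.
  move=> vS vT i p s Vp ip.
  have /eqP := vS i p s (VE p Vp) ip; rewrite subr_eq0 => /eqP ->.
  by have /eqP := vT i p s (VE p Vp) ip; rewrite subr_eq0 => /eqP ->.
have [aN aW aE aS] := Fw h sh; have [bN bW bE bS] := Gw h sh.
have eN := wform_ext hc sgo Vgo aN bN (eq_of _ _ _ fN gN).
have eW := wform_ext hc sgo Vgo aW bW (eq_of _ _ _ fW gW).
have eE := wform_ext hc sgo Vgo aE bE (eq_of _ _ _ fE gE).
have eS := wform_ext hc sgo Vgo aS bS (eq_of _ _ _ fS gS).
by move: eN eW eE eS; case: (F h) (G h) => a b e f [a' b' e' f'] /= -> -> -> ->.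
Qed.

(** The domain of [go] is [W], off which [A] is already 0, so the restriction changes nothing. *)
Lemma west_proca_lift A :
  is_wform c W k (w + k%:R) A -> west (proca_lift c sigma A go) = A.
Proof.
move=> wA; rewrite proca_liftE //=; apply/funext => g; apply/funext => i.
apply/funext => p; apply/funext => s; rewrite /wrestrict.
by case: asboolP => // nWp; rewrite (wform_off _ _ _ wA nWp).
Qed.

Lemma proca_lift_proca A : proca c W go k (w + k%:R) m2 A ->
  tractor_proca c sigma W go k w (proca_lift c sigma A).
Proof.
move=> [wA vA]; split; first exact: (proca_lift_tractor hc hs cg wA).
set F := triv go (proca_lift c sigma A go).
have vN : vanishes_on W (north F) by rewrite /F proca_liftE.
have vE : vanishes_on W (east F) by rewrite /F proca_liftE.
have WE : west F = A go by rewrite /F /= west_proca_lift.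
(* [sigma go] is locally constant, so its logarithmic derivative vanishes. *)
have vS : vanishes_on W (south F).
  rewrite /F proca_liftE // => i p s Wp ip /=; rewrite /iota_dlog.
  by rewrite (vanishes_iotal _ _ (grad_einstein hc hsigma cg)) // mulr0.
have hA i p s : size s != k -> west F i p s = 0.
  by rewrite WE; exact: wform_size wA.
have [_ H] := proca_einstein dpos hc hsigma cg w vN vE vS hA.
rewrite WE in H; have [vy vD] := H vA.
have vX : all_slots (vanishes_on W) (Xstar F) by split.
split=> //; split=> i p s Wp ip;
  have [eN eW eE eS] := Istar_einstein hc hsigma cg F s Wp ip;
  by rewrite ?eN ?eW ?eE ?eS ?vN ?vE ?vS // ?mulr0 ?oppr0 ?addr0.
Qed.

Lemma tractor_proca_bij :
  set_bij (tractor_proca c sigma W go k w) (proca c W go k (w + k%:R) m2)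
          (fun F => west (F go)).
Proof.
split.
- exact: tractor_proca_proca.
- by move=> F G; rewrite !inE => tF tG; exact: tractor_proca_inj.
- move=> A pA; exists (proca_lift c sigma A); first exact: proca_lift_proca.
  by case: pA => wA _; exact: west_proca_lift.
Qed.

End Bijection.

Theorem proposition5p4 (R : realType) (n : nat) (hn : (2 <= n)%N)
    (M : manifold R n.+1) (c : set (metric M)) (hc : conformal_class c)
    (sigma : scale M -> pt M -> R) (hsigma : almost_einstein c sigma)
    (g : metric M) (hg : c g) (k : nat) (w : R) :
  let go := einstein_scale c sigma g in
  let W := ~` zero_locus c sigma in
  let m2 : scal M := fun i p =>
    - (2 * J go i p / n.+1%:R) * (w + k%:R) * (n%:R + w - k%:R) in
  set_bij (tractor_proca c sigma W go k w)
          (proca c W go k (w + k%:R) m2)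
          (fun F => west (F go)).
Proof.
move=> go W m2; have := tractor_proca_bij (ltn0Sn n) hc hsigma hg k w.
by rewrite -[n.+1%:R - 1]/(n.+1%:R - 1%:R) -natrB // subn1.
Qed.
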